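(* Let $\gamma$ be the Euler-Mascheroni constant and $A$ the Glaisher-Kinkelin constant. Then $$\left(\frac{2^2\pi e^{\gamma}}{A^{12}}\right)^{\frac{\pi^2}{6}} = \frac{\sqrt[4]{2}}{1}\cdot\frac{\sqrt[4]{2}}{\sqrt[9]{3}}\cdot\frac{\sqrt[16]{4}}{\sqrt[9]{3}}\cdot\frac{\sqrt[16]{4}}{\sqrt[25]{5}}\cdot\frac{\sqrt[36]{6}}{\sqrt[25]{5}}\cdot\frac{\sqrt[36]{6}}{\sqrt[49]{7}}\cdots = \lim_{N\to\infty}\prod_{k=1}^{N}\left(\frac{(k+1)^{1/(k+1)^2}}{k^{1/k^2}}\right)^{(-1)^{k+1}}.$$
   Context: The Euler-Mascheroni constant is $\gamma=\lim_{n\to\infty}\left(\sum_{k=1}^n \frac1k-\ln n\right)$. The Glaisher-Kinkelin constant is $$A=\lim_{n\to+\infty}\frac{H(n)}{n^{\frac{n^2}{2}+\frac n2+\frac1{12}}\cdot e^{-\frac{n^2}{4}}}=1.28242\ldots,$$ where $H(n)=\prod_{k=1}^n k^k$ is the hyperfactorial. The infinite product is the limit of its partial products, taken factor by factor in the displayed order. *)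

(* Defs.v *)
From Stdlib Require Import Reals Arith.
From Coquelicot Require Import Coquelicot.
Open Scope R_scope.

(* prod_1_to f n = f 1 * f 2 * ... * f n, equal to 1 for n = 0. *)
Fixpoint prod_1_to (f : nat -> R) (n : nat) : R :=
  match n with
  | O => 1
  | S m => prod_1_to f m * f (S m)
  end.

(* Lim_seq is total; the sequences in the next two constants do converge, to
   finite limits, so their values are the actual limits. *)
Definition euler_mascheroni : R :=
  real (Lim_seq (fun n => sum_n_m (fun k => 1 / INR k) 1 n - ln (INR n))).

Definition hyperfactorial (n : nat) : R := prod_1_to (fun k => INR k ^ k) n.

Definition glaisher_kinkelin : R :=
  real (Lim_seq (fun n =>
    hyperfactorial n /
    (Rpower (INR n) (INR n ^ 2 / 2 + INR n / 2 + 1 / 12)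
     * exp (- (INR n ^ 2 / 4))))).

(* The positive n-th root of x, used only for x > 0 and n >= 1. *)
Definition nth_root (n : nat) (x : R) : R := Rpower x (1 / INR n).

(* The k-th displayed factor (k >= 1) in
     2^(1/4)/1 * 2^(1/4)/3^(1/9) * 4^(1/16)/3^(1/9) * 4^(1/16)/5^(1/25) * ...:
   the indices k and k+1 occur in it, the even one in the numerator and the
   odd one in the denominator. The 1 in the first denominator is the first
   root of 1. *)
Definition displayed_factor (k : nat) : R :=
  if Nat.odd k
  then nth_root ((k + 1) ^ 2) (INR (k + 1)) / nth_root (k ^ 2) (INR k)
  else nth_root (k ^ 2) (INR k) / nth_root ((k + 1) ^ 2) (INR (k + 1)).

(* Both bases are positive for k >= 1, so Rpower is the usual real power. *)
Definition alternating_factor (k : nat) : R :=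
  Rpower (Rpower (INR (k + 1)) (1 / INR (k + 1) ^ 2)
          / Rpower (INR k) (1 / INR k ^ 2))
         ((-1) ^ (k + 1)).

(* Main.v *)
Require Import Defs.
From Stdlib Require Import Reals Lra Lia.
From Coquelicot Require Import Coquelicot.
Open Scope R_scope.

(** Write [s] for the sum of [ln k / k^2] over [k >= 1].

    The logarithm of the product is, by summation by parts, twice the sum of
    [(-1)^k ln k / k^2].  Separation of the even terms evaluates it as
    [zeta(2) ln 2 - s] ([alternating_sum_ln_over_sq_lim]), so with
    [zeta(2) = PI^2 / 6] the theorem is equivalent to
    [12 ln A = gamma + ln (2 PI) + 6 s / PI^2] ([glaisher_kinkelin_eq]), the value
    of the derivative of zeta at 2 in terms of [A].

    In the continuous setting this relation follows from the integral of
    [u (1 - u) / x] over [0, N], where [u] is the fractional part of [x].  On the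
    one hand, integration over unit intervals gives [2 ln A + (ln N) / 6 + o(1)];
    on the other hand, one can expand [u (1 - u)] into its Fourier series,
    [sum_j (1 - cos (2 PI j x)) / (PI j)^2], and integrate term by term, and there
    [gamma + ln (2 PI j N)] appears up to [O(1 / N)].

    The proof below replaces [x] by [k / m] with [m = 2 p + 1].  Then the Fourier
    series becomes the finite identity
    [sum_(j <= p) sin^2 (PI j k / m) / sin^2 (PI j / m) = k (m - k) / 2] for
    [0 <= k <= m] ([fejer_sum_eq]), the integral becomes a finite sum over
    [k <= N m], and two summations are exchanged:
    - summation over [j] first leaves differences of harmonic numbers, whose
      limit for [p -> oo] is the logarithm of a hyperfactorial
      ([fejer_average_lim]);
    - summation over [k] first leaves a harmonic number, the source of [gamma],
      and partial sums of [sum cos (k t) / k = - ln (2 sin (t / 2))], which are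
      controlled with an explicit error ([cos_sum_log_sin]).  Then
      [m sin (PI j / m) -> PI j], with Tannery's theorem, produces [ln (2 PI)] and
      [s] ([sum_ln_chord_lim]).

    The remaining error is at most [1 / N] uniformly in [p]
    ([fejer_average_estimate]), so [p -> oo] and then [N -> oo] give the relation,
    together with the convergence of the sequence that defines [A].  The same
    finite identity, summed over one period, yields [zeta(2) = PI^2 / 6]
    ([sum_inv_sq_lim]). *)


(** * Finite sums *)

Fixpoint sum_1_to (f : nat -> R) (n : nat) : R :=
  match n with
  | O => 0
  | S m => sum_1_to f m + f (S m)
  end.

Lemma sum_1_to_ext (f g : nat -> R) (n : nat) :
  (forall k, (1 <= k <= n)%nat -> f k = g k) -> sum_1_to f n = sum_1_to g n.
Proof.
  induction n as [|n IH]; intros H; simpl; [reflexivity|].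
  rewrite IH, H; [reflexivity | lia | intros; apply H; lia].
Qed.

Lemma sum_1_to_plus (f g : nat -> R) (n : nat) :
  sum_1_to (fun k => f k + g k) n = sum_1_to f n + sum_1_to g n.
Proof. induction n as [|n IH]; simpl; lra. Qed.

Lemma sum_1_to_scal (c : R) (f : nat -> R) (n : nat) :
  sum_1_to (fun k => c * f k) n = c * sum_1_to f n.
Proof. induction n as [|n IH]; simpl; [|rewrite IH]; ring. Qed.

Lemma sum_1_to_minus (f g : nat -> R) (n : nat) :
  sum_1_to (fun k => f k - g k) n = sum_1_to f n - sum_1_to g n.
Proof. induction n as [|n IH]; simpl; lra. Qed.

Lemma sum_1_to_const (c : R) (n : nat) : sum_1_to (fun _ => c) n = INR n * c.
Proof. induction n as [|n IH]; [simpl; ring|]. rewrite S_INR; simpl; lra. Qed.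

Lemma sum_1_to_le (f g : nat -> R) (n : nat) :
  (forall k, (1 <= k <= n)%nat -> f k <= g k) -> sum_1_to f n <= sum_1_to g n.
Proof.
  induction n as [|n IH]; intros H; simpl; [lra|].
  apply Rplus_le_compat; [apply IH; intros|]; apply H; lia.
Qed.

Lemma sum_1_to_Rabs (f : nat -> R) (n : nat) :
  Rabs (sum_1_to f n) <= sum_1_to (fun k => Rabs (f k)) n.
Proof.
  induction n as [|n IH]; simpl; [rewrite Rabs_R0; lra|].
  eapply Rle_trans; [apply Rabs_triang | lra].
Qed.

Lemma sum_1_to_exchange (F : nat -> nat -> R) (n p : nat) :
  sum_1_to (fun k => sum_1_to (F k) p) n
  = sum_1_to (fun j => sum_1_to (fun k => F k j) n) p.
Proof.
  induction n as [|n IH]; simpl.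
  - rewrite sum_1_to_const; ring.
  - rewrite IH, <- sum_1_to_plus; reflexivity.
Qed.

Lemma sum_1_to_split (f : nat -> R) (a b : nat) :
  sum_1_to f (a + b) = sum_1_to f a + sum_1_to (fun r => f (a + r)%nat) b.
Proof.
  induction b as [|b IH]; simpl.
  - rewrite Nat.add_0_r; ring.
  - replace (a + S b)%nat with (S (a + b)) by lia; simpl; rewrite IH; ring.
Qed.

(** The even terms are counted twice and the whole sum is taken away. *)
Lemma sum_1_to_alternating (f : nat -> R) (n : nat) :
  sum_1_to (fun k => (-1) ^ k * f k) (2 * n)
  = 2 * sum_1_to (fun k => f (2 * k)%nat) n - sum_1_to f (2 * n).
Proof.
  induction n as [|n IH]; [simpl; ring|].
  replace (2 * S n)%nat with (S (S (2 * n))) by lia.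
  cbn [sum_1_to]; rewrite IH.
  replace (2 * S n)%nat with (S (S (2 * n))) by lia.
  rewrite <- !tech_pow_Rmult, pow_mult; replace ((-1) ^ 2) with 1 by ring; rewrite pow1; ring.
Qed.

Lemma sum_1_to_INR (n : nat) : sum_1_to INR n = INR n * (INR n + 1) / 2.
Proof. induction n as [|n IH]; [simpl; field|]. cbn [sum_1_to]; rewrite IH, !S_INR; field. Qed.

Lemma sum_1_to_INR_sq (n : nat) :
  sum_1_to (fun k => INR k ^ 2) n = INR n * (INR n + 1) * (2 * INR n + 1) / 6.
Proof. induction n as [|n IH]; [simpl; field|]. cbn [sum_1_to]; rewrite IH, !S_INR; field. Qed.

(** * Limits of sequences *)

Lemma is_lim_seq_INR_S_inv : is_lim_seq (fun n => / (INR n + 1)) 0.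
Proof.
  apply is_lim_seq_ext with (fun n => / INR (S n)); [intros; now rewrite S_INR|].
  apply (is_lim_seq_incr_1 (fun n => / INR n)).
  apply (is_lim_seq_inv INR p_infty); [apply is_lim_seq_INR | discriminate].
Qed.

Lemma is_lim_seq_real_unique (u : nat -> R) (a b : R) :
  is_lim_seq u a -> is_lim_seq u b -> a = b.
Proof.
  intros Ha Hb; apply is_lim_seq_unique in Ha, Hb.
  rewrite Ha in Hb; now injection Hb.
Qed.

Lemma is_lim_seq_of_dist (u v : nat -> R) (l : R) :
  (forall n, Rabs (u n - l) <= v n) -> is_lim_seq v 0 -> is_lim_seq u l.
Proof.
  intros H Hv.
  apply is_lim_seq_le_le with (fun n => l - v n) (fun n => l + v n).
  - intros n; apply Rabs_le_between'; apply H.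
  - replace (Finite l) with (Finite (l - 0)) by (f_equal; ring).
    apply is_lim_seq_minus'; [apply is_lim_seq_const | exact Hv].
  - replace (Finite l) with (Finite (l + 0)) by (f_equal; ring).
    apply is_lim_seq_plus'; [apply is_lim_seq_const | exact Hv].
Qed.

Lemma filterlim_ge_id (phi : nat -> nat) :
  (forall n, (n <= phi n)%nat) -> filterlim phi eventually eventually.
Proof.
  intros H P [N HN]; exists N; intros n Hn; apply HN; specialize (H n); lia.
Qed.

Lemma is_lim_seq_of_even (u : nat -> R) (l : R) :
  is_lim_seq (fun n => u (2 * n)%nat) l ->
  is_lim_seq (fun n => u (S n) - u n) 0 ->
  is_lim_seq u l.
Proof.
  intros He Hd; apply is_lim_seq_spec in He, Hd; apply is_lim_seq_spec; intros eps.
  destruct (He (pos_div_2 eps)) as [N1 H1], (Hd (pos_div_2 eps)) as [N2 H2].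
  exists (2 * N1 + N2 + 1)%nat; intros n Hn; simpl in H1, H2.
  destruct (Nat.Even_or_Odd n) as [[k ->]|[k ->]].
  - eapply Rlt_trans; [apply (H1 k); lia|]. destruct eps as [e He']; simpl; lra.
  - replace (2 * k + 1)%nat with (S (2 * k)) by lia.
    replace (u (S (2 * k)) - l)
      with ((u (S (2 * k)) - u (2 * k)%nat - 0) + (u (2 * k)%nat - l)) by ring.
    eapply Rle_lt_trans; [apply Rabs_triang|].
    assert (A1 := H1 k ltac:(lia)); assert (A2 := H2 (2 * k)%nat ltac:(lia)).
    simpl in A1, A2; simpl; lra.
Qed.

(** Tannery's theorem: dominated convergence for sums with a growing number of
    terms. *)
Lemma tannery (f : nat -> nat -> R) (g l : nat -> R) (L : R) :
  (forall j, (1 <= j)%nat -> is_lim_seq (fun p => f p j) (l j)) ->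
  (forall p j, (1 <= j <= p)%nat -> Rabs (f p j) <= g j) ->
  ex_finite_lim_seq (sum_1_to g) ->
  is_lim_seq (sum_1_to l) L ->
  is_lim_seq (fun p => sum_1_to (f p) p) L.
Proof.
  intros Hf Hg [G HG] HL.
  apply is_lim_seq_spec in HG, HL; apply is_lim_seq_spec; intros eps.
  set (e := mkposreal (eps / 5) ltac:(destruct eps; simpl; lra)).
  destruct (HG e) as [J1 H1], (HL e) as [J2 H2].
  set (J := (J1 + J2)%nat).
  assert (Hfin : is_lim_seq (fun p => sum_1_to (f p) J) (sum_1_to l J)).
  { clear -Hf; induction J as [|J IH]; simpl; [apply is_lim_seq_const|].
    apply is_lim_seq_plus'; [apply IH | apply Hf; lia]. }
  apply is_lim_seq_spec in Hfin; destruct (Hfin e) as [P HP].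
  exists (P + J)%nat; intros p Hp.
  assert (A1 := H1 J ltac:(unfold J; lia)); assert (A2 := H1 p ltac:(unfold J in Hp; lia)).
  assert (A3 := H2 J ltac:(unfold J; lia)); assert (A4 := HP p ltac:(lia)).
  assert (A5 : Rabs (sum_1_to (f p) p - sum_1_to (f p) J)
               <= sum_1_to g p - sum_1_to g J).
  { replace p with (J + (p - J))%nat at 2 4 by lia.
    rewrite !sum_1_to_split.
    replace (_ + _ - sum_1_to (f p) J)
      with (sum_1_to (fun r => f p (J + r)%nat) (p - J)) by ring.
    replace (_ + _ - sum_1_to g J)
      with (sum_1_to (fun r => g (J + r)%nat) (p - J)) by ring.
    eapply Rle_trans; [apply sum_1_to_Rabs|].
    apply sum_1_to_le; intros k Hk; apply Hg; lia. }
  simpl in A1, A2, A3, A4.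
  apply Rabs_def2 in A1, A2, A3, A4; apply Rabs_le_between in A5.
  apply Rabs_def1; destruct eps as [ee He]; simpl in *; lra.
Qed.

Lemma sum_1_to_comparison (f g : nat -> R) :
  (forall k, (1 <= k)%nat -> 0 <= f k <= g k) ->
  ex_finite_lim_seq (sum_1_to g) -> ex_finite_lim_seq (sum_1_to f).
Proof.
  intros H [G HG].
  assert (Hg : forall n, sum_1_to g n <= G).
  { intros n; apply (is_lim_seq_incr_compare _ _ HG).
    intros k; simpl; specialize (H (S k) ltac:(lia)); lra. }
  apply ex_finite_lim_seq_incr with G.
  - intros n; simpl; specialize (H (S n) ltac:(lia)); lra.
  - intros n; eapply Rle_trans; [|apply (Hg n)].
    apply sum_1_to_le; intros k Hk; apply H; lia.
Qed.

(** The terms are dominated by a telescoping sequence: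
    [1 / sqrt k - 1 / sqrt (k + 1) >= 1 / (2 (k + 1) sqrt (k + 1))].  The series
    serves as the common majorant for the sums of [1 / k^2] and [ln k / k^2]. *)
Lemma sum_three_halves :
  ex_finite_lim_seq (sum_1_to (fun k => / (INR k * sqrt (INR k)))).
Proof.
  assert (Hpos : forall n, 0 < sqrt (INR (S n))).
  { intros n; apply sqrt_lt_R0, lt_0_INR; lia. }
  apply (ex_finite_lim_seq_incr _ 3).
  - intros n; cbn [sum_1_to].
    assert (0 < / (INR (S n) * sqrt (INR (S n)))); [|lra].
    apply Rinv_0_lt_compat, Rmult_lt_0_compat; [apply lt_0_INR; lia | apply Hpos].
  - assert (H : forall n,
      sum_1_to (fun k => / (INR k * sqrt (INR k))) (S n) <= 3 - 2 / sqrt (INR (S n))).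
    { induction n as [|n IH].
      - simpl; rewrite sqrt_1; lra.
      - cbn [sum_1_to] in *.
        assert (Ha := Hpos n); assert (Hb := Hpos (S n)).
        assert (Ea : INR (S n) = sqrt (INR (S n)) ^ 2)
          by (rewrite pow2_sqrt; [lra|apply pos_INR]).
        assert (Eb : INR (S (S n)) = sqrt (INR (S (S n))) ^ 2)
          by (rewrite pow2_sqrt; [lra|apply pos_INR]).
        assert (Hab : sqrt (INR (S n)) <= sqrt (INR (S (S n))))
          by (apply sqrt_le_1_alt, le_INR; lia).
        assert (Ed : INR (S (S n)) = INR (S n) + 1) by (rewrite (S_INR (S n)); reflexivity).
        rewrite Eb at 1.
        rewrite Ea, Eb in Ed.
        set (a := sqrt (INR (S n))) in *; set (b := sqrt (INR (S (S n)))) in *.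
        assert (K : / (b ^ 2 * b) <= 2 / a - 2 / b); [|lra].
        replace (2 / a - 2 / b) with (2 * (b ^ 2 - a ^ 2) / (a * b * (a + b))) by (field; lra).
        rewrite Ed; replace (2 * (a ^ 2 + 1 - a ^ 2)) with 2 by ring.
        rewrite <- Ed.
        apply Rle_trans with (/ (a * b * b)).
        + apply Rinv_le_contravar; [repeat apply Rmult_lt_0_compat; lra|].
          simpl; rewrite Rmult_1_r; repeat apply Rmult_le_compat_r; lra.
        + apply Rle_trans with (2 / (a * b * (2 * b))).
          * apply Req_le; field; lra.
          * unfold Rdiv; apply Rmult_le_compat_l; [lra|].
            apply Rinv_le_contravar; [repeat apply Rmult_lt_0_compat; lra|].
            apply Rmult_le_compat_l; [apply Rmult_le_pos; lra | lra]. }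
    intros [|n]; [simpl; lra|].
    eapply Rle_trans; [apply H|].
    assert (0 < 2 / sqrt (INR (S n))); [apply Rdiv_lt_0_compat; [lra | apply Hpos] | lra].
Qed.

(** * Bounds for the logarithm *)

Lemma ln_le_sub_1 (x : R) : 0 < x -> ln x <= x - 1.
Proof.
  intros Hx; rewrite <- (ln_exp (x - 1)); apply ln_le; [exact Hx|].
  assert (H := exp_ineq1_le (x - 1)); lra.
Qed.

Lemma ln_le_sqrt (x : R) : 0 < x -> ln x <= 2 * sqrt x.
Proof.
  intros Hx.
  assert (Hs := sqrt_lt_R0 x Hx).
  rewrite <- (sqrt_sqrt x) at 1 by lra.
  rewrite ln_mult by assumption; assert (H := ln_le_sub_1 _ Hs); lra.
Qed.

Lemma INR_ge_1 (n : nat) : (1 <= n)%nat -> 1 <= INR n.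
Proof. intros H; apply (le_INR 1); exact H. Qed.

Lemma is_lim_seq_ln (u : nat -> R) (l : R) :
  0 < l -> is_lim_seq u l -> is_lim_seq (fun n => ln (u n)) (ln l).
Proof.
  intros Hl; apply is_lim_seq_continuous.
  apply derivable_continuous_pt; exists (/ l); apply derivable_pt_lim_ln; exact Hl.
Qed.

Lemma ln_INR_S_bounds (n : nat) :
  (1 <= n)%nat -> 1 / INR (S n) <= ln (INR (S n)) - ln (INR n) <= 1 / INR n.
Proof.
  intros Hn; assert (H := INR_ge_1 n Hn); rewrite S_INR.
  assert (H1 := ln_le_sub_1 ((INR n + 1) / INR n) ltac:(apply Rdiv_lt_0_compat; lra)).
  assert (H2 := ln_le_sub_1 (INR n / (INR n + 1)) ltac:(apply Rdiv_lt_0_compat; lra)).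
  rewrite ln_div in H1, H2 by lra.
  replace ((INR n + 1) / INR n - 1) with (1 / INR n) in H1 by (field; lra).
  replace (INR n / (INR n + 1) - 1) with (- (1 / (INR n + 1))) in H2 by (field; lra).
  lra.
Qed.

(** * Harmonic numbers *)

Definition harmonic (n : nat) : R := sum_1_to (fun k => 1 / INR k) n.

Lemma harmonic_minus_ln_lim :
  is_lim_seq (fun n => harmonic n - ln (INR n)) euler_mascheroni.
Proof.
  (* Convergence has to be established before the value of [Lim_seq] means
     anything: the sequence decreases from n = 1 on and is nonnegative. *)
  assert (E : ex_finite_lim_seq (fun n => harmonic n - ln (INR n))).
  { assert (E : ex_finite_lim_seq (fun n => harmonic (S n) - ln (INR (S n))));
      [|destruct E as [l Hl]; exists l;
        now apply (is_lim_seq_incr_1 (fun n => harmonic n - ln (INR n)))].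
    apply (ex_finite_lim_seq_decr _ 0).
    - intros n; unfold harmonic; cbn [sum_1_to].
      assert (H := ln_INR_S_bounds (S n) ltac:(lia)); lra.
    - assert (H : forall n, ln (INR (S (S n))) <= harmonic (S n)).
      { induction n as [|n IH]; unfold harmonic in *; cbn [sum_1_to] in *.
        - assert (H := ln_INR_S_bounds 1 ltac:(lia)); simpl in *; rewrite ln_1 in H; lra.
        - assert (H := ln_INR_S_bounds (S (S n)) ltac:(lia)); lra. }
      intros n; assert (H1 := ln_INR_S_bounds (S n) ltac:(lia)); specialize (H n).
      assert (0 < 1 / INR (S (S n))).
      { apply Rdiv_lt_0_compat; [lra | apply lt_0_INR; lia]. }
      lra. }
  apply Lim_seq_correct' in E.
  replace euler_mascheroni with (real (Lim_seq (fun n => harmonic n - ln (INR n))));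
    [exact E|].
  unfold euler_mascheroni; f_equal; apply Lim_seq_ext; intros n.
  f_equal; unfold harmonic.
  induction n as [|n IH].
  - now rewrite sum_n_m_zero by lia.
  - rewrite sum_n_Sm by lia; cbn [sum_1_to]; rewrite IH; reflexivity.
Qed.

(** Euler's constant cancels in the difference.  The scale [phi n] is later the
    modulus [2 n + 1]. *)
Lemma harmonic_ratio_lim (a b : nat) (phi : nat -> nat) :
  (1 <= a)%nat -> (1 <= b)%nat -> (forall n, (n <= phi n)%nat) ->
  is_lim_seq (fun n => harmonic (a * phi n) - harmonic (b * phi n))
    (ln (INR a) - ln (INR b)).
Proof.
  intros Ha Hb Hphi; apply is_lim_seq_incr_1.
  assert (K : forall c, (1 <= c)%nat ->
    is_lim_seq (fun n => harmonic (c * phi (S n)) - ln (INR (phi (S n))))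
      (euler_mascheroni + ln (INR c))).
  { intros c Hc.
    apply is_lim_seq_ext with
      (fun n => (harmonic (c * phi (S n)) - ln (INR (c * phi (S n)))) + ln (INR c)).
    - intros n; rewrite mult_INR, ln_mult; [ring | |]; apply lt_0_INR; [lia|].
      specialize (Hphi (S n)); lia.
    - apply is_lim_seq_plus'; [|apply is_lim_seq_const].
      apply (is_lim_seq_subseq (fun n => harmonic n - ln (INR n)) _
               (fun n => c * phi (S n))%nat); [|apply harmonic_minus_ln_lim].
      apply filterlim_ge_id; intros n; specialize (Hphi (S n)); nia. }
  replace (ln (INR a) - ln (INR b))
    with ((euler_mascheroni + ln (INR a)) - (euler_mascheroni + ln (INR b))) by ring.
  eapply is_lim_seq_ext; [|apply is_lim_seq_minus'; [apply (K a Ha)|apply (K b Hb)]].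
  intros n; simpl; ring.
Qed.

Lemma alternating_harmonic_lim :
  is_lim_seq (sum_1_to (fun k => (-1) ^ k * (1 / INR k))) (- ln 2).
Proof.
  apply is_lim_seq_of_even.
  - apply is_lim_seq_ext with (fun n => harmonic (1 * n) - harmonic (2 * n)).
    + intros n; rewrite sum_1_to_alternating, Nat.mul_1_l.
      unfold harmonic; rewrite <- sum_1_to_scal; f_equal.
      apply sum_1_to_ext; intros k Hk.
      rewrite mult_INR; assert (H := INR_ge_1 k ltac:(lia)); simpl; field; lra.
    + replace (- ln 2) with (ln (INR 1) - ln (INR 2)) by 
        (simpl; rewrite ln_1; replace (1 + 1) with 2 by ring; ring).
      apply (harmonic_ratio_lim 1 2 (fun n => n)); lia.
  - apply is_lim_seq_of_dist with (fun n => / (INR n + 1)); [|apply is_lim_seq_INR_S_inv].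
    intros n; cbn [sum_1_to].
    replace (_ + _ - _ - 0) with ((-1) ^ S n * (1 / INR (S n))) by ring.
    rewrite Rabs_mult, pow_1_abs, S_INR.
    assert (H := pos_INR n); rewrite Rabs_pos_eq; [apply Req_le; field; lra|].
    apply Rlt_le, Rdiv_lt_0_compat; lra.
Qed.


(** * Trigonometric sums *)

Lemma cos_INR_PI (k : nat) : cos (INR k * PI) = (-1) ^ k.
Proof.
  induction k as [|k IH]; [simpl; rewrite Rmult_0_l; apply cos_0|].
  rewrite S_INR; replace ((INR k + 1) * PI) with (INR k * PI + PI) by ring.
  rewrite neg_cos, IH; simpl; ring.
Qed.

Lemma sin_INR_PI (k : nat) : sin (INR k * PI) = 0.
Proof. apply sin_eq_0_1; exists (Z.of_nat k); now rewrite <- INR_IZR_INZ. Qed.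

Lemma sin_sq_add_INR_PI (x : R) (n : nat) : sin (x + INR n * PI) ^ 2 = sin x ^ 2.
Proof.
  induction n as [|n IH]; [simpl; rewrite Rmult_0_l, Rplus_0_r; reflexivity|].
  rewrite S_INR; replace (x + (INR n + 1) * PI) with (x + INR n * PI + PI) by ring.
  rewrite neg_sin, <- IH; ring.
Qed.

Lemma sin_sq_half (x : R) : sin x ^ 2 = (1 - cos (2 * x)) / 2.
Proof. rewrite cos_2a_sin; field. Qed.

(** The Dirichlet kernel. *)
Lemma sum_cos (t : R) (n : nat) :
  2 * sin (t / 2) * sum_1_to (fun k => cos (INR k * t)) n
  = sin ((INR n + 1 / 2) * t) - sin (t / 2).
Proof.
  induction n as [|n IH]; cbn [sum_1_to].
  - simpl; replace ((0 + 1 / 2) * t) with (t / 2) by field; ring.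
  - rewrite Rmult_plus_distr_l, IH, S_INR.
    replace ((INR n + 1 + 1 / 2) * t) with ((INR n + 1) * t + t / 2) by field.
    replace ((INR n + 1 / 2) * t) with ((INR n + 1) * t - t / 2) by field.
    rewrite sin_plus, sin_minus; ring.
Qed.

Lemma sum_sin (t : R) (n : nat) :
  2 * sin (t / 2) * sum_1_to (fun k => sin (INR k * t)) n
  = cos (t / 2) - cos ((INR n + 1 / 2) * t).
Proof.
  induction n as [|n IH]; cbn [sum_1_to].
  - simpl; replace ((0 + 1 / 2) * t) with (t / 2) by field; ring.
  - rewrite Rmult_plus_distr_l, IH, S_INR.
    replace ((INR n + 1 + 1 / 2) * t) with ((INR n + 1) * t + t / 2) by field.
    replace ((INR n + 1 / 2) * t) with ((INR n + 1) * t - t / 2) by field.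
    rewrite cos_plus, cos_minus; ring.
Qed.

(** The mean value theorem for [B - G]; it bounds an increment without
    integrals. *)
Lemma sub_le_of_derive_le (G B dG dB : R -> R) (a b : R) :
  a <= b ->
  (forall x, a <= x <= b -> is_derive G x (dG x)) ->
  (forall x, a <= x <= b -> is_derive B x (dB x)) ->
  (forall x, a <= x <= b -> dG x <= dB x) ->
  G b - G a <= B b - B a.
Proof.
  intros Hab HG HB Hle.
  assert (D : forall x, a <= x <= b -> is_derive (fun x => B x - G x) x (dB x - dG x)).
  { intros x Hx; apply (is_derive_minus B G); [apply HB | apply HG]; exact Hx. }
  destruct (MVT_gen (fun x => B x - G x) a b (fun x => dB x - dG x)) as [c [Hc E]].
  - rewrite Rmin_left, Rmax_right by lra; intros; apply D; lra.
  - rewrite Rmin_left, Rmax_right by lra; intros x Hx.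
    apply derivable_continuous_pt; exists (dB x - dG x).
    apply is_derive_Reals, D, Hx.
  - rewrite Rmin_left, Rmax_right in Hc by lra.
    assert (H := Hle c Hc).
    assert (0 <= (dB c - dG c) * (b - a)) by (apply Rmult_le_pos; lra).
    lra.
Qed.

Definition cos_sum (M : nat) (t : R) : R :=
  sum_1_to (fun k => cos (INR k * t) / INR k) M.

Lemma is_derive_cos_sum (M : nat) (t : R) :
  is_derive (cos_sum M) t (- sum_1_to (fun k => sin (INR k * t)) M).
Proof.
  unfold cos_sum; induction M as [|M IH]; cbn [sum_1_to].
  - rewrite Ropp_0; apply (is_derive_const 0).
  - rewrite Ropp_plus_distr.
    apply (is_derive_plus (fun t => sum_1_to (fun k => cos (INR k * t) / INR k) M)
             (fun t => cos (INR (S M) * t) / INR (S M))); [exact IH|].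
    assert (H : INR (S M) <> 0) by (apply not_0_INR; lia).
    set (c := INR (S M)) in *; auto_derive; [trivial | field; exact H].
Qed.

(** The derivative of [cos_sum M t + ln (2 sin (t / 2))] is the oscillating term
    [cos ((M + 1/2) t) / (2 sin (t / 2))].  Its approximate primitive
    [phi t = sin ((M + 1/2) t) / ((2 M + 1) sin (t / 2))] is already [O(1 / M)],
    and once it is subtracted (this amounts to one integration by parts) the
    remaining derivative is dominated by that of
    [B t = 1 / ((2 M + 1) sin (t / 2))].  Comparison with [t = PI], where the sum
    is the alternating harmonic one, fixes the constant. *)
Lemma cos_sum_log_sin (M : nat) (t : R) :
  0 < t <= PI ->
  Rabs ((cos_sum M t + ln (2 * sin (t / 2))) - (cos_sum M PI + ln 2))
  <= 2 / ((2 * INR M + 1) * sin (t / 2)).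
Proof.
  intros Ht; assert (HPI := PI_RGT_0).
  set (q := 2 * INR M + 1).
  assert (Hq : 0 < q) by (unfold q; assert (H := pos_INR M); lra).
  set (phi := fun x => sin ((INR M + 1 / 2) * x) / (q * sin (x / 2))).
  set (G := fun x => cos_sum M x + ln (2 * sin (x / 2)) - phi x).
  set (B := fun x => / (q * sin (x / 2))).
  set (dG := fun x => sin ((INR M + 1 / 2) * x)
                      * (cos (x / 2) / (2 * q * sin (x / 2) ^ 2))).
  set (dB := fun x => - (cos (x / 2) / (2 * q * sin (x / 2) ^ 2))).
  assert (Hs : forall x, t <= x <= PI -> 0 < sin (x / 2)).
  { intros x Hx; apply sin_gt_0; lra. }
  assert (HG : forall x, t <= x <= PI -> is_derive G x (dG x)).
  { intros x Hx; assert (H := Hs x Hx).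
    assert (E := sum_sin x M).
    assert (D2 : is_derive (fun x => ln (2 * sin (x / 2))) x (cos (x / 2) / (2 * sin (x / 2)))).
    { auto_derive; change (x * / 2) with (x / 2); [lra | field; lra]. }
    assert (D3 : is_derive phi x
      (cos ((INR M + 1 / 2) * x) / (2 * sin (x / 2))
       - sin ((INR M + 1 / 2) * x) * cos (x / 2) / (2 * q * sin (x / 2) ^ 2))).
    { unfold phi; auto_derive; change (x * / 2) with (x / 2).
      - assert (0 < q * sin (x / 2)) by (now apply Rmult_lt_0_compat); lra.
      - replace (INR M + 1 / 2) with (q / 2) by (unfold q; field); field; lra. }
    assert (D := is_derive_minus _ phi x _ _
      (is_derive_plus (cos_sum M) _ x _ _ (is_derive_cos_sum M x) D2) D3).
    unfold G; eapply is_derive_ext; [|replace (dG x) with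
       (minus (plus (- sum_1_to (fun k => sin (INR k * x)) M)
                    (cos (x / 2) / (2 * sin (x / 2))))
              (cos ((INR M + 1 / 2) * x) / (2 * sin (x / 2))
               - sin ((INR M + 1 / 2) * x) * cos (x / 2) / (2 * q * sin (x / 2) ^ 2))); [exact D|]].
    - reflexivity.
    - replace (sum_1_to (fun k => sin (INR k * x)) M)
        with ((cos (x / 2) - cos ((INR M + 1 / 2) * x)) / (2 * sin (x / 2)))
        by (rewrite <- E; field; lra).
      unfold dG, minus, plus, opp; simpl; field; lra. }
  assert (HB : forall x, t <= x <= PI -> is_derive B x (dB x)).
  { intros x Hx; assert (H := Hs x Hx).
    assert (0 < q * sin (x / 2)) by (now apply Rmult_lt_0_compat).
    unfold B, dB; auto_derive; change (x * / 2) with (x / 2); [lra | field; lra]. }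
  (* [dG] is [- dB] times a sine, so both [G + B] and [G - B] are monotone. *)
  assert (Hd : forall x, t <= x <= PI -> dB x <= dG x <= - dB x).
  { intros x Hx; unfold dG, dB.
    assert (Hc : 0 <= cos (x / 2) / (2 * q * sin (x / 2) ^ 2)).
    { apply Rmult_le_pos; [apply cos_ge_0; lra|].
      assert (H := Hs x Hx).
      apply Rlt_le, Rinv_0_lt_compat; repeat apply Rmult_lt_0_compat; lra. }
    assert (W := SIN_bound ((INR M + 1 / 2) * x)).
    set (w := sin ((INR M + 1 / 2) * x)) in *.
    set (c := cos (x / 2) / (2 * q * sin (x / 2) ^ 2)) in *.
    split; nra. }
  assert (I1 : B PI - B t <= G PI - G t).
  { apply sub_le_of_derive_le with dB dG; [lra | assumption .. | apply Hd]. }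
  assert (I2 : G PI - G t <= - B PI - - B t).
  { apply (sub_le_of_derive_le G (fun x => - B x) dG (fun x => - dB x)); [lra | assumption | |].
    - intros x Hx; apply (is_derive_opp B), HB, Hx.
    - intros x Hx; apply Hd, Hx. }
  assert (Bt : B t = / (q * sin (t / 2))) by reflexivity.
  assert (sP : sin (PI / 2) = 1) by apply sin_PI2.
  assert (BP : B PI = / q) by (unfold B; rewrite sP, Rmult_1_r; reflexivity).
  assert (Hphi : forall x, t <= x <= PI -> - B x <= phi x <= B x).
  { intros x Hx; unfold phi, B.
    assert (0 < / (q * sin (x / 2))).
    { apply Rinv_0_lt_compat, Rmult_lt_0_compat; [exact Hq | apply Hs, Hx]. }
    assert (W := SIN_bound ((INR M + 1 / 2) * x)).
    set (w := sin ((INR M + 1 / 2) * x)) in *.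
    set (b := / (q * sin (x / 2))) in *.
    change (- b <= w * b <= b); nra. }
  assert (P1 := Hphi t ltac:(lra)); assert (P2 := Hphi PI ltac:(lra)).
  unfold G in I1, I2; rewrite sP, Rmult_1_r in I1, I2.
  replace (2 / (q * sin (t / 2))) with (2 * B t) by (rewrite Bt; reflexivity).
  apply Rabs_le_between; lra.
Qed.

Lemma cos_sum_PI_lim : is_lim_seq (fun M => cos_sum M PI + ln 2) 0.
Proof.
  replace (Finite 0) with (Finite (- ln 2 + ln 2)) by (f_equal; ring).
  apply is_lim_seq_plus'; [|apply is_lim_seq_const].
  apply is_lim_seq_ext with (2 := alternating_harmonic_lim).
  intros M; apply sum_1_to_ext; intros k _; rewrite cos_INR_PI; unfold Rdiv; ring.
Qed.

(** * The Fejer sum over the points [PI j / (2 p + 1)] *)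

Definition modulus (p : nat) : nat := (2 * p + 1)%nat.

(** The modulus is odd, so the angles with [1 <= j <= p] lie strictly between 0
    and [PI / 2] and, up to the sign of their sines, represent all nonzero
    residues. *)
Definition angle (p j : nat) : R := PI * INR j / INR (modulus p).

Lemma INR_modulus (p : nat) : INR (modulus p) = 2 * INR p + 1.
Proof. unfold modulus; rewrite plus_INR, mult_INR; reflexivity. Qed.

Lemma INR_modulus_pos (p : nat) : 0 < INR (modulus p).
Proof. rewrite INR_modulus; assert (H := pos_INR p); lra. Qed.

Lemma angle_bounds (p j : nat) : (1 <= j <= p)%nat -> 0 < angle p j < PI / 2.
Proof.
  intros [H1 H2]; assert (Hm := INR_modulus_pos p); rewrite INR_modulus in Hm.
  apply INR_ge_1 in H1; apply le_INR in H2; assert (HPI := PI_RGT_0).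
  unfold angle; rewrite INR_modulus; split.
  - apply Rdiv_lt_0_compat; [nra | exact Hm].
  - apply Rmult_lt_reg_r with (2 * INR p + 1); [exact Hm|].
    replace (PI * INR j / (2 * INR p + 1) * (2 * INR p + 1)) with (PI * INR j) by (field; lra).
    nra.
Qed.

Lemma sin_angle_pos (p j : nat) : (1 <= j <= p)%nat -> 0 < sin (angle p j).
Proof. intros H; apply angle_bounds in H; apply sin_gt_0; lra. Qed.

Definition fejer_sum (p k : nat) : R :=
  sum_1_to (fun j => sin (INR k * angle p j) ^ 2 / sin (angle p j) ^ 2) p.

Lemma fejer_sum_0 (p : nat) : fejer_sum p 0 = 0.
Proof.
  unfold fejer_sum; rewrite <- (Rmult_0_r (INR p)), <- sum_1_to_const.
  apply sum_1_to_ext; intros j Hj; simpl; rewrite Rmult_0_l, sin_0; unfold Rdiv; ring.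
Qed.

Lemma fejer_sum_1 (p : nat) : fejer_sum p 1 = INR p.
Proof.
  rewrite <- (Rmult_1_r (INR p)), <- sum_1_to_const.
  apply sum_1_to_ext; intros j Hj; assert (H := sin_angle_pos p j Hj).
  simpl; rewrite !Rmult_1_l; field; lra.
Qed.

(** At these points the numerator [sin ((p + 1/2) t)] of the Dirichlet kernel is
    [sin (k PI) = 0]. *)
Lemma sum_cos_angle (p k : nat) :
  (1 <= k < modulus p)%nat ->
  sum_1_to (fun j => cos (2 * (INR k * angle p j))) p = - (1 / 2).
Proof.
  intros Hk; assert (Hm := INR_modulus_pos p).
  assert (Hk1 := INR_ge_1 k ltac:(lia)).
  assert (Hk2 : INR k < INR (modulus p)) by (apply lt_INR; lia).
  assert (HPI := PI_RGT_0).
  set (t := 2 * PI * INR k / INR (modulus p)).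
  assert (Hs : 0 < sin (t / 2)).
  { replace (t / 2) with (PI * (INR k / INR (modulus p))) by (unfold t; field; lra).
    assert (0 < INR k / INR (modulus p) < 1).
    { split; [apply Rdiv_lt_0_compat; lra|].
      apply Rmult_lt_reg_r with (INR (modulus p)); [exact Hm|].
      replace (INR k / INR (modulus p) * INR (modulus p)) with (INR k) by (field; lra); lra. }
    apply sin_gt_0; nra. }
  apply Rmult_eq_reg_l with (2 * sin (t / 2)); [|lra].
  rewrite (sum_1_to_ext _ (fun j => cos (INR j * t)) p).
  - rewrite sum_cos.
    replace ((INR p + 1 / 2) * t) with (INR k * PI);
      [|unfold t; rewrite INR_modulus in *; field; lra].
    rewrite sin_INR_PI; field.
  - intros j _; f_equal; unfold t, angle; field; lra.
Qed.

Lemma sin_sq_second_difference (x a : R) :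
  sin (x + a) ^ 2 - 2 * sin x ^ 2 + sin (x - a) ^ 2 = 2 * sin a ^ 2 * cos (2 * x).
Proof.
  rewrite cos_2a, sin_plus, sin_minus.
  assert (H := sin2_cos2 a); unfold Rsqr in H.
  assert (E : cos a ^ 2 = 1 - sin a ^ 2) by lra.
  replace ((sin x * cos a + cos x * sin a) ^ 2 - 2 * sin x ^ 2
           + (sin x * cos a - cos x * sin a) ^ 2)
    with (2 * sin x ^ 2 * cos a ^ 2 + 2 * cos x ^ 2 * sin a ^ 2 - 2 * sin x ^ 2) by ring.
  rewrite E; ring.
Qed.

(** A discrete and exact form of the Fourier expansion of [x (1 - x)] on [0, 1].
    Both sides agree at [k = 0] and [k = 1], and they have the same second
    difference: on the left, [sin_sq_second_difference] turns it into a sum of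
    cosines, which is [-1] for [0 < k < 2 p + 1]. *)
Lemma fejer_sum_eq (p k : nat) :
  (k <= modulus p)%nat -> fejer_sum p k = INR k * (INR (modulus p) - INR k) / 2.
Proof.
  enough (H : forall k, (k < modulus p)%nat ->
    fejer_sum p k = INR k * (INR (modulus p) - INR k) / 2 /\
    fejer_sum p (S k) = INR (S k) * (INR (modulus p) - INR (S k)) / 2).
  { intros Hk; destruct k as [|k]; [apply (H 0%nat) | apply (H k)]; unfold modulus in *; lia. }
  clear k; induction k as [|k IH]; intros Hk.
  - rewrite fejer_sum_0, fejer_sum_1, INR_modulus; simpl; split; field.
  - destruct IH as [E1 E2]; [lia|]; split; [exact E2|].
    assert (E : fejer_sum p (S (S k)) - 2 * fejer_sum p (S k) + fejer_sum p k = -1).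
    { replace (-1) with (2 * - (1 / 2)) by field.
      rewrite <- (sum_cos_angle p (S k)) by lia.
      unfold fejer_sum; rewrite <- !sum_1_to_scal, <- sum_1_to_minus, <- sum_1_to_plus.
      apply sum_1_to_ext; intros j Hj; assert (Hs := sin_angle_pos p j Hj).
      rewrite !(S_INR (S k)).
      assert (D := sin_sq_second_difference (INR (S k) * angle p j) (angle p j)).
      replace ((INR (S k) + 1) * angle p j) with (INR (S k) * angle p j + angle p j) by ring.
      replace (INR k * angle p j) with (INR (S k) * angle p j - angle p j)
        by (rewrite S_INR; ring).
      apply Rmult_eq_reg_r with (sin (angle p j) ^ 2); [|apply pow_nonzero; lra].
      transitivity (2 * sin (angle p j) ^ 2 * cos (2 * (INR (S k) * angle p j))); [|ring].
      rewrite <- D; field; lra. }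
    rewrite E1, E2 in E; rewrite !S_INR in *; lra.
Qed.

Lemma fejer_sum_periodic (p i r : nat) :
  fejer_sum p (i * modulus p + r) = fejer_sum p r.
Proof.
  apply sum_1_to_ext; intros j _; f_equal.
  rewrite <- (sin_sq_add_INR_PI (INR r * angle p j) (i * j)).
  do 2 f_equal; unfold angle; rewrite plus_INR, !mult_INR.
  assert (H := INR_modulus_pos p); field; lra.
Qed.

Lemma sum_sin_sq_angle (p j : nat) :
  (1 <= j <= p)%nat ->
  sum_1_to (fun k => sin (INR k * angle p j) ^ 2) (modulus p) = INR (modulus p) / 2.
Proof.
  intros Hj; assert (Hs := sin_angle_pos p j Hj); assert (Hm := INR_modulus_pos p).
  assert (Z : sum_1_to (fun k => cos (INR k * (2 * angle p j))) (modulus p) = 0).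
  { apply Rmult_eq_reg_l with (2 * sin (angle p j)); [|lra].
    assert (E := sum_cos (2 * angle p j) (modulus p)).
    replace (2 * angle p j / 2) with (angle p j) in E by field.
    rewrite E.
    replace ((INR (modulus p) + 1 / 2) * (2 * angle p j))
      with (angle p j + 2 * INR j * PI) by (unfold angle; field; lra).
    rewrite sin_period; ring. }
  rewrite (sum_1_to_ext _ (fun k => 1 / 2 - 1 / 2 * cos (INR k * (2 * angle p j)))).
  - rewrite sum_1_to_minus, sum_1_to_const, sum_1_to_scal, Z; field.
  - intros k _; rewrite sin_sq_half.
    replace (2 * (INR k * angle p j)) with (INR k * (2 * angle p j)) by ring; field.
Qed.

(** Summation of [fejer_sum p k] over a full period in two ways: by
    [fejer_sum_eq], and term by term, where every [sin^2] has mean [1 / 2]. *)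
Lemma sum_inv_sin_sq (p : nat) :
  sum_1_to (fun j => / sin (angle p j) ^ 2) p = (INR (modulus p) ^ 2 - 1) / 6.
Proof.
  assert (Hm := INR_modulus_pos p).
  apply Rmult_eq_reg_l with (INR (modulus p) / 2); [|lra].
  rewrite <- sum_1_to_scal.
  transitivity (sum_1_to (fejer_sum p) (modulus p)).
  - unfold fejer_sum; rewrite sum_1_to_exchange.
    apply sum_1_to_ext; intros j Hj; rewrite <- (sum_sin_sq_angle p j Hj).
    rewrite Rmult_comm, <- sum_1_to_scal.
    apply sum_1_to_ext; intros k _; unfold Rdiv; ring.
  - rewrite (sum_1_to_ext _ (fun k => INR (modulus p) / 2 * INR k - 1 / 2 * INR k ^ 2)).
    + rewrite sum_1_to_minus, !sum_1_to_scal, sum_1_to_INR, sum_1_to_INR_sq; field.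
    + intros k Hk; rewrite fejer_sum_eq by lia; field.
Qed.


(** * Limits as the modulus grows *)

Lemma modulus_inv_lim : is_lim_seq (fun p => / INR (modulus p)) 0.
Proof.
  apply is_lim_seq_of_dist with (fun n => / (INR n + 1)); [|apply is_lim_seq_INR_S_inv].
  intros n; assert (H := pos_INR n); rewrite INR_modulus, Rminus_0_r.
  rewrite Rabs_pos_eq; [|apply Rlt_le, Rinv_0_lt_compat; lra].
  apply Rinv_le_contravar; lra.
Qed.

Lemma sin_cubic_bounds (x : R) : 0 <= x <= PI -> x - x ^ 3 / 6 <= sin x <= x.
Proof.
  intros [H1 H2]; split.
  - destruct (sin_bound x 0 H1 H2) as [H _].
    eapply Rle_trans; [|exact H].
    unfold sin_approx, sin_term; simpl; apply Req_le; field.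
  - destruct (Req_dec x 0) as [->|Hx]; [rewrite sin_0; lra|].
    apply Rlt_le, sin_lt_x; lra.
Qed.

(** Half the length of the chord between the points 0 and [j] of a regular
    polygon with [modulus p] vertices on the circle of radius [modulus p]; it tends
    to half the arc, [PI j], and being at least [j] it bounds the terms of the sums
    below uniformly in [p]. *)
Definition chord (p j : nat) : R := INR (modulus p) * sin (angle p j).

Lemma modulus_mult_angle (p j : nat) : INR (modulus p) * angle p j = PI * INR j.
Proof. unfold angle; assert (H := INR_modulus_pos p); field; lra. Qed.

Lemma chord_ge (p j : nat) : (1 <= j <= p)%nat -> INR j <= chord p j.
Proof.
  intros Hj; assert (Ha := angle_bounds p j Hj); assert (Hm := INR_modulus_pos p).
  assert (HPI := PI_4); assert (HPI' := PI2_3_2).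
  assert (Hs := proj1 (sin_cubic_bounds (angle p j) ltac:(lra))).
  assert (E := modulus_mult_angle p j).
  assert (H3 : angle p j / 3 <= sin (angle p j)).
  { eapply Rle_trans; [|exact Hs].
    set (a := angle p j) in *.
    replace (a - a ^ 3 / 6) with (a / 3 + a * (4 - a ^ 2) / 6) by field.
    assert (0 <= a * (4 - a ^ 2)) by (apply Rmult_le_pos; nra); lra. }
  unfold chord; apply Rle_trans with (INR (modulus p) * (angle p j / 3)).
  - replace (INR (modulus p) * (angle p j / 3)) with (PI * INR j / 3) by (rewrite <- E; field).
    assert (H := pos_INR j); nra.
  - apply Rmult_le_compat_l; lra.
Qed.

Lemma chord_lim (j : nat) : is_lim_seq (fun p => chord p j) (PI * INR j).
Proof.
  (* The bounds on [sin] need [angle p j <= PI], which holds from p = j on. *)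
  apply (is_lim_seq_incr_n _ j).
  apply is_lim_seq_of_dist with
    (fun n => (PI * INR j) ^ 3 / 6 * (/ INR (modulus (n + j)) * / INR (modulus (n + j)))).
  - intros n; set (p := (n + j)%nat).
    destruct (Nat.eq_dec j 0) as [->|Hj0].
    + unfold chord, angle; simpl INR; unfold Rdiv.
      rewrite Rmult_0_r, Rmult_0_l, sin_0, Rmult_0_r, Rminus_0_r, Rabs_R0.
      apply Req_le; ring.
    + assert (Hj : (1 <= j <= p)%nat) by (unfold p; lia).
      assert (Ha := angle_bounds p j Hj); assert (Hm := INR_modulus_pos p).
      assert (Hs := sin_cubic_bounds (angle p j) ltac:(assert (H := PI_RGT_0); lra)).
      rewrite <- (modulus_mult_angle p j); unfold chord.
      set (a := angle p j) in *; set (m := INR (modulus p)) in *.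
      replace ((m * a) ^ 3 / 6 * (/ m * / m)) with (m * (a ^ 3 / 6)) by (field; lra).
      apply Rabs_le_between; split; nra.
  - replace (Finite 0) with (Finite ((PI * INR j) ^ 3 / 6 * (0 * 0))) by (f_equal; ring).
    apply (is_lim_seq_scal_l _ _ (Finite (0 * 0))), is_lim_seq_mult';
      apply (is_lim_seq_incr_n (fun p => / INR (modulus p)) j), modulus_inv_lim.
Qed.

Lemma inv_sq_le_three_halves (x y : R) : 1 <= y -> y <= x -> / x ^ 2 <= / (y * sqrt y).
Proof.
  intros Hy Hx; assert (Hs : 1 <= sqrt y) by (rewrite <- sqrt_1; apply sqrt_le_1_alt, Hy).
  assert (Es := sqrt_sqrt y ltac:(lra)).
  apply Rinv_le_contravar; nra.
Qed.

Lemma ln_over_sq_le_three_halves (x y : R) :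
  1 <= y -> y <= x -> ln x / x ^ 2 <= 2 * / (y * sqrt y).
Proof.
  intros Hy Hx; assert (Hs : sqrt y <= sqrt x) by (apply sqrt_le_1_alt, Hx).
  assert (Hs' : 1 <= sqrt y) by (rewrite <- sqrt_1; apply sqrt_le_1_alt, Hy).
  assert (Es := sqrt_sqrt x ltac:(lra)).
  apply Rle_trans with (2 * / (x * sqrt x)).
  - apply Rle_trans with (2 * sqrt x / x ^ 2).
    + apply Rmult_le_compat_r; [apply Rlt_le, Rinv_0_lt_compat; nra | apply ln_le_sqrt; lra].
    + apply Req_le; set (s := sqrt x) in *; clearbody s; rewrite <- Es; field; lra.
  - apply Rmult_le_compat_l; [lra|]; apply Rinv_le_contravar; nra.
Qed.

Lemma inv_chord_sq_lim (j : nat) :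
  (1 <= j)%nat -> is_lim_seq (fun p => / chord p j ^ 2) (/ (PI * INR j) ^ 2).
Proof.
  intros Hj; assert (H := INR_ge_1 j Hj); assert (HPI := PI_RGT_0).
  assert (0 < PI * INR j) by nra.
  apply (is_lim_seq_inv _ (Finite ((PI * INR j) ^ 2))).
  - apply is_lim_seq_ext with (fun p => chord p j * chord p j); [intros; ring|].
    replace ((PI * INR j) ^ 2) with (PI * INR j * (PI * INR j)) by ring.
    apply is_lim_seq_mult'; apply chord_lim.
  - intros E; apply (pow_nonzero (PI * INR j) 2); [lra | now injection E].
Qed.

Lemma sum_inv_chord_sq (p : nat) :
  sum_1_to (fun j => / chord p j ^ 2) p = 1 / 6 - 1 / 6 * (/ INR (modulus p) * / INR (modulus p)).
Proof.
  assert (Hm := INR_modulus_pos p).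
  rewrite (sum_1_to_ext _ (fun j => / INR (modulus p) ^ 2 * / sin (angle p j) ^ 2)).
  - rewrite sum_1_to_scal, sum_inv_sin_sq; field; lra.
  - intros j Hj; assert (H := sin_angle_pos p j Hj); unfold chord; field; lra.
Qed.

Lemma sum_inv_chord_sq_lim : is_lim_seq (fun p => sum_1_to (fun j => / chord p j ^ 2) p) (1 / 6).
Proof.
  apply is_lim_seq_ext with
    (fun p => 1 / 6 - 1 / 6 * (/ INR (modulus p) * / INR (modulus p)));
    [intros; symmetry; apply sum_inv_chord_sq|].
  replace (Finite (1 / 6)) with (Finite (1 / 6 - 1 / 6 * (0 * 0))) by (f_equal; ring).
  apply is_lim_seq_minus'; [apply is_lim_seq_const|].
  apply (is_lim_seq_scal_l _ _ (Finite (0 * 0))), is_lim_seq_mult'; apply modulus_inv_lim.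
Qed.

(** The finite identity [sum_inv_sin_sq] gives the limit [1 / 6], and by
    [tannery] the same limit is the sum of [1 / (PI k)^2]. *)
Lemma sum_inv_sq_lim : is_lim_seq (sum_1_to (fun k => / INR k ^ 2)) (PI ^ 2 / 6).
Proof.
  assert (HPI := PI_RGT_0).
  assert (E : ex_finite_lim_seq (sum_1_to (fun k => / INR k ^ 2))).
  { apply sum_1_to_comparison with (2 := sum_three_halves).
    intros k Hk; apply INR_ge_1 in Hk; split.
    - apply Rlt_le, Rinv_0_lt_compat; nra.
    - apply inv_sq_le_three_halves; lra. }
  destruct E as [L HL]; replace (PI ^ 2 / 6) with L; [exact HL|].
  assert (T : is_lim_seq (fun p => sum_1_to (fun j => / chord p j ^ 2) p) (/ PI ^ 2 * L)).
  { apply tannery with (l := fun j => / (PI * INR j) ^ 2)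
      (g := fun j => / (INR j * sqrt (INR j))).
    - apply inv_chord_sq_lim.
    - intros p j Hj; assert (H := chord_ge p j Hj); assert (H1 := INR_ge_1 j (proj1 Hj)).
      rewrite Rabs_pos_eq; [apply inv_sq_le_three_halves; lra|].
      apply Rlt_le, Rinv_0_lt_compat; nra.
    - apply sum_three_halves.
    - apply is_lim_seq_ext with (fun n => / PI ^ 2 * sum_1_to (fun k => / INR k ^ 2) n).
      + intros n; rewrite <- sum_1_to_scal; apply sum_1_to_ext; intros k Hk.
        assert (H := INR_ge_1 k (proj1 Hk)); field; lra.
      + apply (is_lim_seq_scal_l _ _ (Finite L)), HL. }
  assert (E := is_lim_seq_real_unique _ _ _ T sum_inv_chord_sq_lim).
  replace L with (PI ^ 2 * (/ PI ^ 2 * L)) by (field; lra); rewrite E; field.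
Qed.

Definition ln_over_sq (k : nat) : R := ln (INR k) / INR k ^ 2.

Lemma sum_ln_over_sq_ex_lim :
  ex_finite_lim_seq (sum_1_to ln_over_sq).
Proof.
  apply sum_1_to_comparison with (g := fun k => 2 * / (INR k * sqrt (INR k))).
  - intros k Hk; apply INR_ge_1 in Hk; split.
    + apply Rmult_le_pos; [|apply Rlt_le, Rinv_0_lt_compat; nra].
      rewrite <- ln_1; apply ln_le; lra.
    + apply ln_over_sq_le_three_halves; lra.
  - destruct sum_three_halves as [l Hl]; exists (2 * l).
    apply is_lim_seq_ext with (fun n => 2 * sum_1_to (fun k => / (INR k * sqrt (INR k))) n);
      [intros; symmetry; apply sum_1_to_scal|].
    apply (is_lim_seq_scal_l _ _ (Finite l)), Hl.
Qed.

Lemma sum_ln_chord_lim (s : R) :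
  is_lim_seq (sum_1_to ln_over_sq) s ->
  is_lim_seq (fun p => sum_1_to (fun j => ln (2 * chord p j) / chord p j ^ 2) p)
    (ln (2 * PI) / 6 + s / PI ^ 2).
Proof.
  intros HS; assert (HPI := PI_RGT_0).
  apply tannery with (l := fun j => ln (2 * (PI * INR j)) / (PI * INR j) ^ 2)
    (g := fun j => 16 * / (INR j * sqrt (INR j))).
  - intros j Hj; assert (H1 := INR_ge_1 j Hj).
    apply is_lim_seq_mult'; [|apply inv_chord_sq_lim, Hj].
    apply is_lim_seq_ln; [nra|].
    apply (is_lim_seq_scal_l _ _ (Finite (PI * INR j))), chord_lim.
  - intros p j Hj; assert (H := chord_ge p j Hj); assert (H1 := INR_ge_1 j (proj1 Hj)).
    set (x := chord p j) in *.
    assert (Hln : 0 <= ln (2 * x)) by (rewrite <- ln_1; apply ln_le; lra).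
    assert (Hi : 0 < / x ^ 2) by (apply Rinv_0_lt_compat; nra).
    rewrite Rabs_pos_eq; [|apply Rmult_le_pos; lra].
    assert (B := ln_over_sq_le_three_halves (2 * x) (INR j) H1 ltac:(lra)).
    replace (ln (2 * x) / (2 * x) ^ 2) with (ln (2 * x) / x ^ 2 / 4) in B by (field; lra).
    assert (0 < / (INR j * sqrt (INR j))); [|lra].
    apply Rinv_0_lt_compat, Rmult_lt_0_compat; [lra | apply sqrt_lt_R0; lra].
  - destruct sum_three_halves as [l Hl]; exists (16 * l).
    apply is_lim_seq_ext with (fun n => 16 * sum_1_to (fun k => / (INR k * sqrt (INR k))) n);
      [intros; symmetry; apply sum_1_to_scal|].
    apply (is_lim_seq_scal_l _ _ (Finite l)), Hl.
  - apply is_lim_seq_ext with (fun n =>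
      ln (2 * PI) / PI ^ 2 * sum_1_to (fun k => / INR k ^ 2) n
      + / PI ^ 2 * sum_1_to ln_over_sq n).
    + intros n; rewrite <- !sum_1_to_scal, <- sum_1_to_plus.
      apply sum_1_to_ext; intros k Hk; assert (H := INR_ge_1 k (proj1 Hk)).
      unfold ln_over_sq; rewrite <- Rmult_assoc, (ln_mult (2 * PI)) by lra; field; lra.
    + replace (ln (2 * PI) / 6 + s / PI ^ 2)
        with (ln (2 * PI) / PI ^ 2 * (PI ^ 2 / 6) + / PI ^ 2 * s) by (field; lra).
      apply is_lim_seq_plus'.
      * apply (is_lim_seq_scal_l _ _ (Finite (PI ^ 2 / 6))), sum_inv_sq_lim.
      * apply (is_lim_seq_scal_l _ _ (Finite s)), HS.
Qed.

(** * The harmonic average of the Fejer sum *)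

(** Since [2 fejer_sum p k / (2 p + 1)^2] is [u (1 - u)] with [u] the fractional
    part of [k / (2 p + 1)], this is a Riemann sum, with step [1 / (2 p + 1)], for
    the integral of [u (1 - u) / x] over [0, N], [u] the fractional part of [x]. *)
Definition fejer_average (p N : nat) : R :=
  2 / INR (modulus p) ^ 2 * sum_1_to (fun k => fejer_sum p k / INR k) (N * modulus p).

Lemma harmonic_add (a b : nat) :
  sum_1_to (fun r => 1 / INR (a + r)) b = harmonic (a + b) - harmonic a.
Proof. unfold harmonic; rewrite sum_1_to_split; ring. Qed.

(** The terms with [k = N m + r], [1 <= r <= m], where [m = modulus p].  Here
    [r (m - r) = (N m + r) (m (1 + N) - r) - m^2 N (N + 1)], so that division by
    [N m + r] leaves a linear sum and a difference of harmonic numbers. *)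
Lemma fejer_average_S (p N : nat) :
  fejer_average p (S N)
  = fejer_average p N
    + ((1 / 2 + INR N) - 1 / 2 * / INR (modulus p)
       - INR N * (INR N + 1) * (harmonic (S N * modulus p) - harmonic (N * modulus p))).
Proof.
  assert (Hm := INR_modulus_pos p).
  unfold fejer_average.
  replace (S N * modulus p)%nat with (N * modulus p + modulus p)%nat by lia.
  rewrite <- harmonic_add, sum_1_to_split, Rmult_plus_distr_l; f_equal.
  set (m := INR (modulus p)) in *.
  rewrite (sum_1_to_ext _ (fun r => 1 / 2 * ((m * (1 + INR N) - INR r)
     - m ^ 2 * (INR N * (INR N + 1)) * (1 / INR (N * modulus p + r))))).
  - rewrite sum_1_to_scal, sum_1_to_minus, sum_1_to_minus, sum_1_to_const, sum_1_to_scal,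
      sum_1_to_INR; fold m; field; lra.
  - intros r Hr; rewrite fejer_sum_periodic, fejer_sum_eq by lia.
    rewrite plus_INR, mult_INR; fold m.
    assert (H1 := INR_ge_1 r (proj1 Hr)); assert (H2 := pos_INR N).
    assert (0 <= INR N * m) by nra; field; lra.
Qed.

Lemma hyperfactorial_pos (n : nat) : 0 < hyperfactorial n.
Proof.
  unfold hyperfactorial; induction n as [|n IH]; cbn [prod_1_to]; [lra|].
  apply Rmult_lt_0_compat; [exact IH|]; apply pow_lt, lt_0_INR; lia.
Qed.

Lemma ln_hyperfactorial_S (n : nat) :
  ln (hyperfactorial (S n)) = ln (hyperfactorial n) + INR (S n) * ln (INR (S n)).
Proof.
  assert (H : 0 < INR (S n)) by (apply lt_0_INR; lia).
  change (hyperfactorial (S n)) with (hyperfactorial n * INR (S n) ^ S n).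
  rewrite ln_mult, ln_pow; [reflexivity | exact H | apply hyperfactorial_pos | now apply pow_lt].
Qed.

(** Each block of [modulus p] terms tends to
    [1/2 + N - N (N + 1) (ln (N + 1) - ln N)], and summation by parts turns the
    sum of the blocks into the logarithm of the hyperfactorial. *)
Lemma fejer_average_lim (N : nat) :
  is_lim_seq (fun p => fejer_average p N)
    (INR N ^ 2 / 2 - (INR N ^ 2 + INR N) * ln (INR N) + 2 * ln (hyperfactorial N)).
Proof.
  induction N as [|N IH].
  - replace (hyperfactorial 0) with 1 by reflexivity; rewrite ln_1.
    apply is_lim_seq_ext with (fun _ => 0); [intros p; unfold fejer_average; simpl; ring|].
    simpl INR; replace (0 ^ 2 / 2 - (0 ^ 2 + 0) * ln 0 + 2 * 0) with 0 by field.
    apply is_lim_seq_const.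
  - apply is_lim_seq_ext with (1 := fun p => eq_sym (fejer_average_S p N)).
    rewrite ln_hyperfactorial_S, S_INR.
    replace ((INR N + 1) ^ 2 / 2 - ((INR N + 1) ^ 2 + (INR N + 1)) * ln (INR N + 1)
             + 2 * (ln (hyperfactorial N) + (INR N + 1) * ln (INR N + 1)))
      with ((INR N ^ 2 / 2 - (INR N ^ 2 + INR N) * ln (INR N) + 2 * ln (hyperfactorial N))
            + ((1 / 2 + INR N) - 1 / 2 * 0
               - INR N * (INR N + 1) * (ln (INR N + 1) - ln (INR N)))) by field.
    apply is_lim_seq_plus'; [exact IH|].
    apply is_lim_seq_minus'; [apply is_lim_seq_minus'; [apply is_lim_seq_const|]|].
    + apply (is_lim_seq_scal_l _ _ (Finite 0)), modulus_inv_lim.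
    + destruct N as [|N].
      * (* The harmonic difference diverges here, but its coefficient is zero. *)
        simpl INR; replace (0 * (0 + 1) * (ln (0 + 1) - ln 0)) with 0 by ring.
        apply is_lim_seq_ext with (fun _ => 0); [intros; ring | apply is_lim_seq_const].
      * apply (is_lim_seq_scal_l _ _ (Finite (ln (INR (S N) + 1) - ln (INR (S N))))).
        rewrite <- (S_INR (S N)); apply harmonic_ratio_lim; unfold modulus; lia.
Qed.

(** The same average with the two summations exchanged and
    [sin^2 x = (1 - cos (2 x)) / 2]. *)
Lemma fejer_average_cos_sum (p N : nat) :
  fejer_average p N
  = sum_1_to (fun j => / chord p j ^ 2
      * (harmonic (N * modulus p) - cos_sum (N * modulus p) (2 * angle p j))) p.
Proof.
  assert (Hm := INR_modulus_pos p).
  unfold fejer_average, fejer_sum; set (M := (N * modulus p)%nat).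
  rewrite (sum_1_to_ext _ (fun k => sum_1_to (fun j =>
    / INR k * (sin (INR k * angle p j) ^ 2 / sin (angle p j) ^ 2)) p)).
  - rewrite sum_1_to_exchange, <- sum_1_to_scal.
    apply sum_1_to_ext; intros j Hj; assert (Hs := sin_angle_pos p j Hj).
    unfold harmonic, cos_sum; rewrite <- sum_1_to_minus, <- !sum_1_to_scal.
    apply sum_1_to_ext; intros k Hk; assert (H := INR_ge_1 k (proj1 Hk)).
    rewrite sin_sq_half; unfold chord.
    replace (2 * (INR k * angle p j)) with (INR k * (2 * angle p j)) by ring.
    field; lra.
  - intros k _; rewrite sum_1_to_scal; unfold Rdiv; ring.
Qed.

(** Insertion of [cos_sum_log_sin] for [M = N (2 p + 1)]: the j-th error is at most
    [1 / (M sin (angle p j)) = 1 / (N chord p j) <= 1 / N], uniformly in [p], and the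
    weights [1 / chord^2] add up to less than [1 / 6]. *)
Lemma fejer_average_estimate (p N : nat) :
  (1 <= N)%nat ->
  Rabs (fejer_average p N
        - (((harmonic (N * modulus p) - ln (INR (N * modulus p))) + ln (INR N)
            - (cos_sum (N * modulus p) PI + ln 2)) * sum_1_to (fun j => / chord p j ^ 2) p
           + sum_1_to (fun j => ln (2 * chord p j) / chord p j ^ 2) p))
  <= / INR N.
Proof.
  intros HN; assert (Hm := INR_modulus_pos p); assert (HN1 := INR_ge_1 N HN).
  rewrite fejer_average_cos_sum.
  set (M := (N * modulus p)%nat).
  assert (EM : INR M = INR N * INR (modulus p)) by (unfold M; apply mult_INR).
  rewrite <- sum_1_to_scal, <- sum_1_to_plus, <- sum_1_to_minus.
  eapply Rle_trans; [apply sum_1_to_Rabs|].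
  apply Rle_trans with (sum_1_to (fun j => / INR N * / chord p j ^ 2) p).
  - apply sum_1_to_le; intros j Hj.
    assert (Hs := sin_angle_pos p j Hj); assert (Ha := angle_bounds p j Hj).
    assert (Hc := chord_ge p j Hj); assert (Hj1 := INR_ge_1 j (proj1 Hj)).
    assert (B := cos_sum_log_sin M (2 * angle p j) ltac:(lra)).
    replace (2 * angle p j / 2) with (angle p j) in B by field.
    assert (E : ln (2 * chord p j)
                = ln (2 * sin (angle p j)) + ln (INR M) - ln (INR N)).
    { rewrite EM, (ln_mult (INR N)) by lra; unfold chord.
      replace (2 * (INR (modulus p) * sin (angle p j)))
        with (2 * sin (angle p j) * INR (modulus p)) by ring.
      rewrite (ln_mult (2 * sin (angle p j))) by lra; ring. }
    rewrite E.
    set (d := _ - _) in B.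
    replace (_ - _) with (/ chord p j ^ 2 * - d) by (unfold d, Rdiv; ring).
    rewrite Rabs_mult, Rabs_Ropp, Rabs_pos_eq, Rmult_comm;
      [|apply Rlt_le, Rinv_0_lt_compat; nra].
    apply Rmult_le_compat_r; [apply Rlt_le, Rinv_0_lt_compat; nra|].
    eapply Rle_trans; [exact B|].
    assert (Hq : 0 < (2 * INR M + 1) * sin (angle p j)).
    { apply Rmult_lt_0_compat; [assert (HM := pos_INR M); lra | exact Hs]. }
    apply Rmult_le_reg_r with ((2 * INR M + 1) * sin (angle p j)); [exact Hq|].
    replace (2 / ((2 * INR M + 1) * sin (angle p j)) * ((2 * INR M + 1) * sin (angle p j)))
      with 2 by (field; split; intros Z; rewrite Z in Hq; lra).
    apply Rle_trans with (/ INR N * (2 * INR N * chord p j)).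
    + replace (/ INR N * (2 * INR N * chord p j)) with (2 * chord p j) by (field; lra); lra.
    + apply Rmult_le_compat_l; [apply Rlt_le, Rinv_0_lt_compat; lra|].
      rewrite EM; unfold chord; nra.
  - rewrite sum_1_to_scal, sum_inv_chord_sq.
    assert (0 < / INR (modulus p)) by now apply Rinv_0_lt_compat.
    assert (0 < / INR N) by (apply Rinv_0_lt_compat; lra).
    nra.
Qed.

(** * The Glaisher-Kinkelin constant *)

(** The limit [p -> oo] of [fejer_average_estimate] at fixed [N]; the weight
    [1 / 6] in front of [ln N] produces the exponent [1 / 12] in the definition of
    the Glaisher-Kinkelin constant. *)
Lemma ln_glaisher_sequence_dist (s : R) (N : nat) :
  is_lim_seq (sum_1_to ln_over_sq) s ->
  (1 <= N)%nat ->
  Rabs ((INR N ^ 2 / 2 - (INR N ^ 2 + INR N + 1 / 6) * ln (INR N)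
         + 2 * ln (hyperfactorial N))
        - (euler_mascheroni / 6 + ln (2 * PI) / 6 + s / PI ^ 2)) <= / INR N.
Proof.
  intros HS HN.
  assert (Hphi : filterlim (fun p => N * modulus p)%nat eventually eventually).
  { apply filterlim_ge_id; intros n; unfold modulus; nia. }
  assert (L := is_lim_seq_minus' _ _ _ _ (fejer_average_lim N)
    (is_lim_seq_plus' _ _ _ _
      (is_lim_seq_mult' _ _ _ _
        (is_lim_seq_minus' _ _ _ _
          (is_lim_seq_plus' _ _ _ _
            (is_lim_seq_subseq _ _ _ Hphi harmonic_minus_ln_lim)
            (is_lim_seq_const (ln (INR N))))
          (is_lim_seq_subseq _ _ _ Hphi cos_sum_PI_lim))
        sum_inv_chord_sq_lim)
      (sum_ln_chord_lim s HS))).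
  apply is_lim_seq_abs in L.
  assert (K := is_lim_seq_le _ _ _ _ (fun p => fejer_average_estimate p N HN) L
                 (is_lim_seq_const (/ INR N))).
  simpl in K.
  eapply Rle_trans; [|exact K]; apply Req_le; f_equal; simpl; field.
  assert (H := PI_RGT_0); lra.
Qed.

(** As [Lim_seq] is total, the value relies on the convergence, which comes with
    the explicit rate [1 / N] of the preceding lemma. *)
Lemma glaisher_kinkelin_eq (s : R) :
  is_lim_seq (sum_1_to ln_over_sq) s ->
  glaisher_kinkelin
  = exp ((euler_mascheroni / 6 + ln (2 * PI) / 6 + s / PI ^ 2) / 2).
Proof.
  intros HS; set (l := euler_mascheroni / 6 + ln (2 * PI) / 6 + s / PI ^ 2).
  unfold glaisher_kinkelin.
  rewrite (is_lim_seq_unique _ (Finite (exp (l / 2)))); [reflexivity|].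
  apply is_lim_seq_incr_1.
  apply is_lim_seq_ext with (fun n => exp ((INR (S n) ^ 2 / 2
    - (INR (S n) ^ 2 + INR (S n) + 1 / 6) * ln (INR (S n))
    + 2 * ln (hyperfactorial (S n))) / 2)).
  - intros n; unfold Rpower; set (N := S n).
    rewrite <- (exp_ln (hyperfactorial N)) at 2 by apply hyperfactorial_pos.
    rewrite <- exp_plus; unfold Rdiv at 4; rewrite <- exp_Ropp, <- exp_plus.
    f_equal; field.
  - apply is_lim_seq_continuous; [apply derivable_continuous_pt, derivable_pt_exp|].
    apply (is_lim_seq_scal_r _ (/ 2) (Finite l)).
    apply is_lim_seq_of_dist with (fun n => / (INR n + 1)); [|apply is_lim_seq_INR_S_inv].
    intros n; rewrite <- (S_INR n); apply ln_glaisher_sequence_dist; [exact HS | lia].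
Qed.

(** * The product *)

Definition log_factor (k : nat) : R :=
  (-1) ^ (k + 1) * (ln_over_sq (S k) - ln_over_sq k).

Lemma pow_neg1_odd (k : nat) : (-1) ^ (k + 1) = if Nat.odd k then 1 else -1.
Proof.
  induction k as [|k IH]; [simpl; ring|].
  rewrite Nat.odd_succ, <- Nat.negb_odd; simpl; rewrite IH.
  destruct (Nat.odd k); simpl; ring.
Qed.

Lemma alternating_factor_eq (k : nat) :
  (1 <= k)%nat -> alternating_factor k = exp (log_factor k).
Proof.
  intros Hk; apply INR_ge_1 in Hk.
  unfold alternating_factor, Rpower, log_factor, ln_over_sq, Rdiv.
  rewrite <- exp_Ropp, <- exp_plus, ln_exp, Nat.add_1_r.
  f_equal; ring.
Qed.

Lemma displayed_factor_eq (k : nat) :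
  (1 <= k)%nat -> displayed_factor k = exp (log_factor k).
Proof.
  intros Hk; apply INR_ge_1 in Hk.
  unfold displayed_factor, nth_root, Rpower, log_factor, ln_over_sq.
  rewrite pow_neg1_odd, !pow_INR, !Nat.add_1_r.
  destruct (Nat.odd k); unfold Rdiv; rewrite <- exp_Ropp, <- exp_plus; f_equal; ring.
Qed.

Lemma prod_1_to_exp (f g : nat -> R) (n : nat) :
  (forall k, (1 <= k)%nat -> f k = exp (g k)) ->
  prod_1_to f n = exp (sum_1_to g n).
Proof.
  intros H; induction n as [|n IH]; cbn [prod_1_to sum_1_to]; [now rewrite exp_0|].
  rewrite IH, H, exp_plus by lia; reflexivity.
Qed.

(** Summation by parts; the boundary term at 1 vanishes because [ln 1 = 0]. *)
Lemma sum_log_factor (n : nat) :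
  sum_1_to log_factor n
  = 2 * sum_1_to (fun k => (-1) ^ k * ln_over_sq k) n + (-1) ^ S n * ln_over_sq (S n).
Proof.
  induction n as [|n IH]; cbn [sum_1_to].
  - unfold ln_over_sq; simpl INR; rewrite ln_1; simpl; field.
  - rewrite IH; unfold log_factor; rewrite Nat.add_1_r; simpl; ring.
Qed.

Lemma alternating_ln_over_sq_lim_0 :
  is_lim_seq (fun n => (-1) ^ S n * ln_over_sq (S n)) 0.
Proof.
  destruct sum_ln_over_sq_ex_lim as [s HS].
  apply is_lim_seq_abs_0.
  apply is_lim_seq_ext with
    (fun n => Rabs (sum_1_to ln_over_sq (S n) - sum_1_to ln_over_sq n)).
  - intros n; cbn [sum_1_to].
    rewrite Rabs_mult, pow_1_abs, Rmult_1_l; f_equal; ring.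
  - apply (proj1 (is_lim_seq_abs_0 _)).
    replace (Finite 0) with (Finite (s - s)) by (f_equal; ring).
    apply is_lim_seq_minus'; [|exact HS].
    now apply (is_lim_seq_incr_1 (sum_1_to ln_over_sq)).
Qed.

(** The sum is the derivative at 2 of [eta z = (1 - 2^(1 - z)) zeta z].  The even
    terms, [ln (2 k) / (2 k)^2 = (ln 2 + ln k) / (4 k^2)], express it by the sums of
    [1 / k^2] and [ln k / k^2]. *)
Lemma alternating_sum_ln_over_sq_lim (s : R) :
  is_lim_seq (sum_1_to ln_over_sq) s ->
  is_lim_seq (sum_1_to (fun k => (-1) ^ k * ln_over_sq k)) ((PI ^ 2 / 6 * ln 2 - s) / 2).
Proof.
  intros HS; apply is_lim_seq_of_even.
  - apply is_lim_seq_ext with (fun n =>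
      (ln 2 / 2 * sum_1_to (fun k => / INR k ^ 2) n + 1 / 2 * sum_1_to ln_over_sq n)
      - sum_1_to ln_over_sq (2 * n)).
    + intros n; rewrite sum_1_to_alternating, <- !sum_1_to_scal, <- sum_1_to_plus.
      f_equal; apply sum_1_to_ext; intros k Hk; assert (H := INR_ge_1 k (proj1 Hk)).
      unfold ln_over_sq; rewrite mult_INR; replace (INR 2) with 2 by reflexivity.
      rewrite ln_mult by lra; field; lra.
    + replace ((PI ^ 2 / 6 * ln 2 - s) / 2)
        with (ln 2 / 2 * (PI ^ 2 / 6) + 1 / 2 * s - s) by field.
      apply is_lim_seq_minus'; [apply is_lim_seq_plus'|].
      * apply (is_lim_seq_scal_l _ _ (Finite (PI ^ 2 / 6))), sum_inv_sq_lim.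
      * apply (is_lim_seq_scal_l _ _ (Finite s)), HS.
      * apply (is_lim_seq_subseq _ _ (fun n => 2 * n)%nat); [|exact HS].
        apply filterlim_ge_id; intros n; lia.
  - apply is_lim_seq_ext with (2 := alternating_ln_over_sq_lim_0).
    intros n; cbn [sum_1_to]; ring.
Qed.

Lemma prod_exp_log_factor_lim (f : nat -> R) :
  (forall k, (1 <= k)%nat -> f k = exp (log_factor k)) ->
  is_lim_seq (prod_1_to f)
    (Finite (Rpower (2 ^ 2 * PI * exp euler_mascheroni / glaisher_kinkelin ^ 12)
                    (PI ^ 2 / 6))).
Proof.
  intros Hf; assert (HPI := PI_RGT_0).
  destruct sum_ln_over_sq_ex_lim as [s HS].
  replace (Rpower _ _) with (exp (2 * ((PI ^ 2 / 6 * ln 2 - s) / 2) + 0)).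
  - apply is_lim_seq_ext with (fun n => exp (sum_1_to log_factor n)).
    + intros n; symmetry; apply prod_1_to_exp, Hf.
    + apply is_lim_seq_continuous; [apply derivable_continuous_pt, derivable_pt_exp|].
      apply is_lim_seq_ext with (1 := fun n => eq_sym (sum_log_factor n)).
      apply is_lim_seq_plus'; [|apply alternating_ln_over_sq_lim_0].
      apply (is_lim_seq_scal_l _ _ (Finite ((PI ^ 2 / 6 * ln 2 - s) / 2))).
      apply alternating_sum_ln_over_sq_lim, HS.
  - rewrite (glaisher_kinkelin_eq s HS); unfold Rpower; f_equal.
    set (x := (euler_mascheroni / 6 + ln (2 * PI) / 6 + s / PI ^ 2) / 2).
    assert (Hx := exp_pos x); assert (Hg := exp_pos euler_mascheroni).
    assert (H1 : 0 < 2 ^ 2 * PI) by lra.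
    assert (H2 : 0 < 2 ^ 2 * PI * exp euler_mascheroni) by now apply Rmult_lt_0_compat.
    assert (H3 : 0 < exp x ^ 12) by now apply pow_lt.
    rewrite (ln_div _ _ H2 H3), (ln_mult _ _ H1 Hg), (ln_mult (2 ^ 2)) by lra.
    rewrite (ln_pow 2) by lra; rewrite (ln_pow _ _ Hx), !ln_exp.
    unfold x; rewrite ln_mult by lra; simpl INR; field; lra.
Qed.

Theorem mainTheorem3 :
  is_lim_seq (prod_1_to displayed_factor)
    (Finite (Rpower (2 ^ 2 * PI * exp euler_mascheroni / glaisher_kinkelin ^ 12)
                    (PI ^ 2 / 6)))
  /\
  is_lim_seq (prod_1_to alternating_factor)
    (Finite (Rpower (2 ^ 2 * PI * exp euler_mascheroni / glaisher_kinkelin ^ 12)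
                    (PI ^ 2 / 6))).
Proof.
  split; apply prod_exp_log_factor_lim.
  - exact displayed_factor_eq.
  - exact alternating_factor_eq.
Qed.
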